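(* Let $P$ be a finite poset, $\mathbb{K}$ a field of characteristic zero and $C\in\mathbb{K}$ a generic constant. Then, as birational maps $\mathbb{K}^P\dashrightarrow\mathbb{K}^P$, $\operatorname{BAR}=\nabla\circ\Theta\circ\Delta^{-1}$, and moreover $\nabla\circ\operatorname{BOR}=\operatorname{BAR}\circ\nabla$.
   Context: $\mathbb{K}^P$ is the set of labelings $f:P\to\mathbb{K}$. Let $\widehat P$ be $P$ with a new minimum $\widehat 0$ and new maximum $\widehat 1$ adjoined; $x\lessdot y$ means $y$ covers $x$ in $\widehat P$. Products of maps denote composition, the rightmost applied first. A linear extension of $P$ is a listing $(x_1,\dots,x_n)$ of all elements of $P$ such that $x_i<x_j$ implies $i<j$. Birational order toggle: for $v\in P$, $T_v$ fixes all labels except at $v$, where $(T_vf)(v)=\dfrac{\sum_{y\in\widehat P,\,y\lessdot v}f(y)}{f(v)\sum_{y\in\widehat P,\,y\gtrdot v}1/f(y)}$, with the convention $f(\widehat0)=1$, $f(\widehat1)=C$. $\operatorname{BOR}=T_{x_1}T_{x_2}\cdots T_{x_n}$ for a linear extension $(x_1,\dots,x_n)$. Birational antichain toggle: for $v\in P$, $\tau_v$ fixes all labels except at $v$, where $(\tau_vg)(v)=C/\sum_{(y_1,\dots,y_k)}g(y_1)\cdots g(y_k)$, the sum over all maximal chains of $P$ containing $v$. $\operatorname{BAR}=\tau_{x_n}\cdots\tau_{x_2}\tau_{x_1}$ for a linear extension $(x_1,\dots,x_n)$ (i.e. toggling from bottom to top). Transfer maps (for $x\in P$): $(\Theta f)(x)=C/f(x)$;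 $(\nabla f)(x)=f(x)/\sum_{y\lessdot x}f(y)$ with $f(\widehat0)=1$; $(\Delta f)(x)=f(x)/\sum_{y\gtrdot x}f(y)$ with $f(\widehat1)=1$; $(\nabla^{-1}f)(x)=\sum f(y_1)\cdots f(y_k)$ over chains $\widehat0\lessdot y_1\lessdot\cdots\lessdot y_k=x$; $(\Delta^{-1}f)(x)=\sum f(y_1)\cdots f(y_k)$ over chains $x=y_1\lessdot\cdots\lessdot y_k\lessdot\widehat1$. *)

(* Defs.v *)
From HB Require Import structures.
From mathcomp Require Import all_boot all_order all_algebra.
From mathcomp Require Import fraction generic_quotient.
From mathcomp Require Import mpoly.

Set Implicit Arguments.
Unset Strict Implicit.
Unset Printing Implicit Defensive.

Import Order.TTheory GRing.Theory.
Local Open Scope ring_scope.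

Definition hat (T : Type) : Type := option (option T).
Definition hat0 {T : Type} : hat T := Some None.
Definition hat1 {T : Type} : hat T := None.
Definition inhat {T : Type} (x : T) : hat T := Some (Some x).

HB.instance Definition _ (T : finType) := Finite.on (hat T).

Section HatOrder.
Variables (d : Order.disp_t) (P : finPOrderType d).

Definition hat_lt (x y : hat P) : bool :=
  match x, y with
  | None, _ => false
  | Some _, None => true
  | Some None, Some y' => y' != None
  | Some (Some _), Some None => false
  | Some (Some x'), Some (Some y') => (x' < y')%O
  end.

Fact hat_lt_irr : irreflexive hat_lt.
Proof. by case=> [[x|]|] //=; rewrite ltxx. Qed.

Fact hat_lt_trans : transitive hat_lt.
Proof. by case=> [[y|]|] [[x|]|] [[z|]|] //=; apply: lt_trans. Qed.

HB.instance Definition _ :=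
  Order.Lt_isPOrder.Build d (hat P) hat_lt_irr hat_lt_trans.

End HatOrder.

Definition covered (d : Order.disp_t) (Q : finPOrderType d) : rel Q :=
  fun x y => (x < y)%O && [forall z, ~~ ((x < z)%O && (z < y)%O)].

Definition linear_extension (d : Order.disp_t) (P : finPOrderType d)
    (s : seq P) : Prop :=
  [/\ uniq s, forall x, x \in s
    & forall x y, (x < y)%O -> (index x s < index y s)%N].

Definition chain (d : Order.disp_t) (P : finPOrderType d) : pred {set P} :=
  fun A => [forall x in A, forall y in A, (x >=< y)%O].

(* The formulas defining the maps, for labelings with values in any field L.
   They are only ever applied to the generic labeling below, where no
   denominator vanishes (as soon as C != 0). *)
Section Formulas.
Variables (d : Order.disp_t) (P : finPOrderType d) (L : fieldType).
Implicit Types (C : L) (f g : P -> L) (v x : P).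

Definition hat_label (c0 c1 : L) f (y : hat P) : L :=
  match y with
  | Some (Some x) => f x
  | Some None => c0
  | None => c1
  end.

Definition order_toggle_formula C v f x : L :=
  if x == v then
    (\sum_(y : hat P | covered y (inhat v)) hat_label 1 C f y)
    / (f v * \sum_(y : hat P | covered (inhat v) y) (hat_label 1 C f y)^-1)
  else f x.

Definition antichain_toggle_formula C v g x : L :=
  if x == v then
    C / \sum_(A : {set P} | maxset (@chain d P) A && (v \in A))
          \prod_(y in A) g y
  else g x.

Definition Theta_formula C f x : L := C / f x.

(* [hat1] is covered by nothing, hence never occurs as an index here. *)
Definition nabla_formula f x : L :=
  f x / \sum_(y : hat P | covered y (inhat x)) hat_label 1 1 f y.

(* The sum over all chains x = y_1, ..., y_k in which each element is covered
   by the next one and y_k is covered by hat1; such chains are duplicate-free,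
   so k <= #|P|. *)
Definition Delta_inv_formula f x : L :=
  \sum_(k < #|P|.+1)
    \sum_(s : k.-tuple P |
        (ohead s == Some x)
        && sorted (@covered _ (hat P)) (rcons (map inhat s) hat1))
      \prod_(y <- s) f y.

End Formulas.

(* A rational map K^P --> K^P is the tuple of its components, which are
   elements of the function field K(X_p : p in P) of K^P; two rational maps
   are equal iff these tuples are. *)
Section RationalMaps.
Variables (P : finType) (K : fieldType).

Definition ratfun : fieldType := {fraction {mpoly K[#|P|]}}.
Definition ratmap : Type := {ffun P -> ratfun}.

Definition ratconst (c : K) : ratfun := tofrac (c%:MP : {mpoly K[#|P|]}).

Definition generic_label (x : P) : ratfun :=
  tofrac ('X_(enum_rank x) : {mpoly K[#|P|]}).

Definition ratmap_of (Phi : (P -> ratfun) -> P -> ratfun) : ratmap :=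
  [ffun x => Phi generic_label x].

Definition poly_subst (F : ratmap) (p : {mpoly K[#|P|]}) : ratfun :=
  mmap ratconst (fun i => F (enum_val i)) p.

Definition dominant (F : ratmap) : Prop := injective (poly_subst F).

(* For F dominant, poly_subst F extends uniquely to the function field, so the
   choice of representative of r as a quotient is immaterial.  For F not
   dominant the value of [ratcomp G F] carries no meaning. *)
Definition rat_subst (F : ratmap) (r : ratfun) : ratfun :=
  poly_subst F (\n_(repr r)) / poly_subst F (\d_(repr r)).

Definition ratcomp (G F : ratmap) : ratmap := [ffun x => rat_subst F (G x)].
Definition ratid : ratmap := ratmap_of id.

Definition birational (F : ratmap) : Prop :=
  dominant F /\
  exists G : ratmap, [/\ dominant G, ratcomp F G = ratid & ratcomp G F = ratid].

End RationalMaps.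

Arguments ratconst {P K} c.

Declare Scope ratmap_scope.
Delimit Scope ratmap_scope with ratmap.
Notation "G \o F" := (ratcomp G F) : ratmap_scope.

Section Rowmotion.
Variables (d : Order.disp_t) (P : finPOrderType d) (K : fieldType).
Implicit Types (C : K) (v : P) (s : seq P).

Definition order_toggle C v : ratmap P K :=
  ratmap_of (order_toggle_formula (ratconst C) v).

Definition antichain_toggle C v : ratmap P K :=
  ratmap_of (antichain_toggle_formula (ratconst C) v).

Definition Theta C : ratmap P K := ratmap_of (Theta_formula (ratconst C)).
Definition nabla : ratmap P K := ratmap_of (@nabla_formula d P (ratfun P K)).
Definition Delta_inv : ratmap P K :=
  ratmap_of (@Delta_inv_formula d P (ratfun P K)).

(* T_{x_1} T_{x_2} ... T_{x_n} for s = [:: x_1; ...; x_n] *)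
Definition BOR C s : ratmap P K :=
  foldr (fun v F => order_toggle C v \o F)%ratmap (ratid P K) s.

(* tau_{x_n} ... tau_{x_2} tau_{x_1} for s = [:: x_1; ...; x_n] *)
Definition BAR C s : ratmap P K :=
  foldl (fun F v => antichain_toggle C v \o F)%ratmap (ratid P K) s.

End Rowmotion.

Arguments Theta {d P K} C.
Arguments nabla {d P K}.
Arguments Delta_inv {d P K}.

(* Main.v *)
(** Everything is computed on the generic labeling.  A rational function that is
   defined at a point of L^P, L being the function field, has a value there, and
   specialization at F is compatible with the field operations as long as no
   denominator vanishes.  If G specializes at F to the identity, a polynomial
   relation between the components of G would specialize to one between the
   variables; hence mutually inverse formulas give dominant, even birational,
   maps.  The denominators that occur are subtraction-free in the labels (up to
   a power of C), so they do not vanish at the all-ones labeling in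
   characteristic zero.

   The sum over the maximal chains through v factors into the part below v and
   the part from v upwards, the latter being Delta^-1.  Toggling from bottom to
   top, the labels below v are already those of nabla Theta Delta^-1 while those
   from v upwards are untouched, so the lower factor is the sum of
   Theta Delta^-1 over the elements covered by v, and the toggle at v produces
   the value of nabla Theta Delta^-1.  In the same way toggling from top to
   bottom yields BOR = Theta Delta^-1 nabla, whence the second identity. *)

Require Import Defs.
From HB Require Import structures.
From mathcomp Require Import all_boot all_order all_algebra.
From mathcomp Require Import fraction generic_quotient mpoly.

Set Implicit Arguments.
Unset Strict Implicit.
Unset Printing Implicit Defensive.

Import Order.TTheory GRing.Theory.
Local Open Scope ring_scope.

(** * Specialization of fractions *)

Section Specialization.
Variables (R : idomainType) (L L' : fieldType).
Variables (iota : {rmorphism R -> L}) (sigma : {rmorphism R -> L'}).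
Hypothesis iota_inj : injective iota.
Implicit Types (r : L) (u : L').

(* For [L] the fraction field of [R]: [r] lies in the local ring of the kernel
   of [sigma], and [u] is its value under the extension of [sigma]. *)
Definition specializes r u : Prop :=
  exists a b, [/\ sigma b != 0, r = iota a / iota b & u = sigma a / sigma b].

Lemma specializes_neq0 b : sigma b != 0 -> iota b != 0.
Proof.
rewrite -(rmorph0 iota) (inj_eq iota_inj).
by apply: contra_neq => ->; rewrite rmorph0.
Qed.

Lemma specializes_base a : specializes (iota a) (sigma a).
Proof. by exists a, 1; rewrite !rmorph1 !divr1 oner_neq0. Qed.

Lemma specializes0 : specializes 0 0.
Proof. by have := specializes_base 0; rewrite !rmorph0. Qed.

Lemma specializes1 : specializes 1 1.
Proof. by have := specializes_base 1; rewrite !rmorph1. Qed.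

Lemma specializesD r u r' u' :
  specializes r u -> specializes r' u' -> specializes (r + r') (u + u').
Proof.
case=> a [b [b0 -> ->]] [a' [b' [b'0 -> ->]]].
exists (a * b' + a' * b), (b * b').
have nz := specializes_neq0 b0; have nz' := specializes_neq0 b'0.
by split; rewrite ?addf_div // ?rmorphD !rmorphM ?mulf_neq0.
Qed.

Lemma specializesM r u r' u' :
  specializes r u -> specializes r' u' -> specializes (r * r') (u * u').
Proof.
case=> a [b [b0 -> ->]] [a' [b' [b'0 -> ->]]].
by exists (a * a'), (b * b'); split; rewrite !rmorphM ?mulf_neq0 // mulf_div.
Qed.

Lemma specializesX r u n : specializes r u -> specializes (r ^+ n) (u ^+ n).
Proof.
by move=> spr; elim: n => [|n IHn]; rewrite ?expr0 ?exprS;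
  [apply: specializes1 | apply: specializesM].
Qed.

Lemma specializes_unique r u u' : specializes r u -> specializes r u' -> u = u'.
Proof.
case=> a [b [b0 -> ->]] [a' [b' [b'0 + ->]]].
have nz := specializes_neq0 b0; have nz' := specializes_neq0 b'0.
move/eqP; rewrite eqr_div // -!rmorphM (inj_eq iota_inj) => /eqP e.
by apply/eqP; rewrite eqr_div // -!rmorphM e.
Qed.

Lemma specializes_inj0 r : injective sigma -> specializes r 0 -> r = 0.
Proof.
move=> sigma_inj [a [b [b0 -> /esym/eqP]]].
rewrite mulf_eq0 invr_eq0 (negPf b0) orbF -(rmorph0 sigma).
by rewrite (inj_eq sigma_inj) => /eqP ->; rewrite rmorph0 mul0r.
Qed.

(* When [sigma] is injective even the convention [0^-1 = 0] is respected. *)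
Lemma specializesV r u :
  injective sigma \/ u != 0 -> specializes r u -> specializes r^-1 u^-1.
Proof.
move=> safe spr; have [u0|nzu] := eqVneq u 0.
  case: safe => [sigma_inj|]; last by rewrite u0 eqxx.
  rewrite u0 in spr *; rewrite (specializes_inj0 sigma_inj spr) !invr0.
  exact: specializes0.
move: nzu; case: spr => a [b [b0 -> ->]] nzu; exists b, a.
split; rewrite ?invf_div //.
by apply: contraNneq nzu => ->; rewrite mul0r.
Qed.

Lemma specializes_div r u r' u' : injective sigma \/ u' != 0 ->
  specializes r u -> specializes r' u' -> specializes (r / r') (u / u').
Proof. by move=> safe spr /(specializesV safe); apply: specializesM. Qed.

Lemma specializes_sum (I : Type) (s : seq I) (Q : pred I) f g :
  (forall i, Q i -> specializes (f i) (g i)) ->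
  specializes (\sum_(i <- s | Q i) f i) (\sum_(i <- s | Q i) g i).
Proof.
by move=> fg; apply: (big_ind2 specializes) => //;
  [apply: specializes0 | move=> *; apply: specializesD].
Qed.

Lemma specializes_prod (I : Type) (s : seq I) (Q : pred I) f g :
  (forall i, Q i -> specializes (f i) (g i)) ->
  specializes (\prod_(i <- s | Q i) f i) (\prod_(i <- s | Q i) g i).
Proof.
by move=> fg; apply: (big_ind2 specializes) => //;
  [apply: specializes1 | move=> *; apply: specializesM].
Qed.

(** * Positive rational values as a certificate of nonvanishing *)

Hypothesis natr_neq0 : forall n, n.+1%:R != 0 :> L'.

(** The value of [r] at [sigma] is the positive rational number (m+1)/(n+1), with the denominator
    cleared. This stands in for an order on [L']: the property is stable under sums, products and
    inverses, and excludes zero. *)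
Definition positive r : Prop :=
  exists u m n, specializes r u /\ u * n.+1%:R = m.+1%:R.

Lemma positive_neq0 r : positive r -> r != 0.
Proof.
case=> u [m [n [spr e]]]; apply: contra_neq (natr_neq0 m) => r0.
rewrite -e (specializes_unique spr (u' := 0)) ?mul0r // r0.
exact: specializes0.
Qed.

Lemma positive_of_specializes1 r : specializes r 1 -> positive r.
Proof. by move=> spr; exists 1, 0%N, 0%N; rewrite mulr1. Qed.

Lemma positive1 : positive 1.
Proof. exact/positive_of_specializes1/specializes1. Qed.

Lemma positiveD r r' : positive r -> positive r' -> positive (r + r').
Proof.
case=> u [m [n [spr e]]] [u' [m' [n' [spr' e']]]].
(* Numerator and denominator of the sum of the two fractions; the predecessors are there because
   [positive] stores m and n for m+1 and n+1. *)
exists (u + u'), (m.+1 * n'.+1 + m'.+1 * n.+1).-1%N, (n.+1 * n'.+1).-1%N.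
split; first exact: specializesD.
rewrite !prednK ?addn_gt0 ?muln_gt0 // natrD !natrM -e -e' mulrDl mulrA.
by congr (_ + _); rewrite [_%:R * _]mulrC mulrA.
Qed.

Lemma positiveM r r' : positive r -> positive r' -> positive (r * r').
Proof.
case=> u [m [n [spr e]]] [u' [m' [n' [spr' e']]]].
exists (u * u'), (m.+1 * m'.+1).-1%N, (n.+1 * n'.+1).-1%N.
split; first exact: specializesM.
by rewrite !prednK ?muln_gt0 // !natrM -e -e' mulrACA.
Qed.

Lemma positiveV r : positive r -> positive r^-1.
Proof.
case=> u [m [n [spr e]]]; have nzm := natr_neq0 m.
have nzu : u != 0 by apply: contra_neq nzm => u0; rewrite -e u0 mul0r.
exists u^-1, n, m; split; first by apply: specializesV => //; right.
by rewrite -e mulKf.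
Qed.

(** The index [i0] rules out the empty sum. Once its term is set aside, the remaining sum is either
    zero or positive. *)
Lemma positive_sum (I : finType) (Q : pred I) f i0 : Q i0 ->
  (forall i, Q i -> positive (f i)) -> positive (\sum_(i | Q i) f i).
Proof.
move=> Qi0 pos_f; rewrite (bigD1 i0) //=.
suff [->|pos] : \sum_(i | Q i && (i != i0)) f i = 0 \/
                positive (\sum_(i | Q i && (i != i0)) f i).
- by rewrite addr0; apply: pos_f.
- by apply: positiveD => //; apply: pos_f.
apply: (big_ind (fun r => r = 0 \/ positive r)) => [|r r'|i /andP[Qi _]].
- by left.
- by move=> [->|pr] [->|pr']; rewrite ?addr0 ?add0r; auto;
  right; apply: positiveD.
- by right; apply: pos_f.
Qed.

End Specialization.

(** * Constants and polynomial substitution as ring morphisms *)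

Section RatconstMorphism.
Variables (P : finType) (K : fieldType).

Fact ratconst_is_zmod_morphism : zmod_morphism (@ratconst P K).
Proof. by move=> x y; rewrite /ratconst !rmorphB. Qed.

Fact ratconst_is_monoid_morphism : monoid_morphism (@ratconst P K).
Proof. by split=> [|x y]; rewrite /ratconst ?rmorph1 ?rmorphM. Qed.

HB.instance Definition _ := GRing.isZmodMorphism.Build K (ratfun P K)
  (@ratconst P K) ratconst_is_zmod_morphism.
HB.instance Definition _ := GRing.isMonoidMorphism.Build K (ratfun P K)
  (@ratconst P K) ratconst_is_monoid_morphism.

End RatconstMorphism.

HB.instance Definition _ (P : finType) (K : fieldType) (F : ratmap P K) :=
  GRing.RMorphism.copy (poly_subst F)
    (mmap (@ratconst P K) (fun i => F (enum_val i))).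

(** * Rational maps *)

Section RationalMapTheory.
Variables (P : finType) (K : fieldType).
Local Notation L := (ratfun P K).
Local Notation X := (@generic_label P K).
Local Notation poly := {mpoly K[#|P|]}.
Implicit Types (F G : ratmap P K) (r u : L) (p q : poly).

Definition embed : {rmorphism poly -> L} := @tofrac poly.

Lemma embed_inj : injective embed.
Proof. by move=> p q /eqP; rewrite tofrac_eq => /eqP. Qed.

Definition specializes_at F : L -> L -> Prop :=
  specializes embed (poly_subst F).

Lemma poly_substC F c : poly_subst F c%:MP = ratconst c.
Proof. exact: mmapC. Qed.

Lemma poly_substX F i : poly_subst F 'X_i = F (enum_val i).
Proof. by rewrite /poly_subst mmapX mmap1U. Qed.

Lemma specializes_label F x : specializes_at F (X x) (F x).
Proof.
have := specializes_base embed (poly_subst F) 'X_(enum_rank x).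
by rewrite /= poly_substX enum_rankK.
Qed.

Lemma specializes_const F c : specializes_at F (ratconst c) (ratconst c).
Proof.
by have := specializes_base embed (poly_subst F) c%:MP; rewrite /= poly_substC.
Qed.

(** Substituting into a polynomial uses only sums, products and constants, so no denominator can
    vanish. *)
Lemma specializes_poly_subst F G G' p :
  (forall x, specializes_at F (G x) (G' x)) ->
  specializes_at F (poly_subst G p) (poly_subst G' p).
Proof.
move=> GG'; apply: (specializes_sum embed_inj) => m _.
apply: specializesM; first exact: specializes_const.
by apply: specializes_prod => i _; apply: specializesX; apply: GG'.
Qed.

Lemma poly_subst_id p : poly_subst (ratid P K) p = embed p.
Proof.
have {2}-> : p = mmap (@mpolyC _ K) (fun i => 'X_i) p.
  rewrite /mmap {1}(mpolyE p); apply: eq_bigr => m _.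
  by rewrite mul_mpolyC mmap1_id.
rewrite [embed _]raddf_sum; apply: eq_bigr => m _.
rewrite [RHS]rmorphM; congr (_ * _).
rewrite [RHS]rmorph_prod; apply: eq_bigr => i _.
rewrite [RHS]rmorphXn /ratid /ratmap_of ffunE /= /generic_label.
by rewrite enum_valK.
Qed.

(** Links the chosen representative used by [rat_subst] to division in the function field; the
    equality is cross-multiplication in the quotient of pairs. *)
Lemma frac_repr r : r = embed (\n_(repr r)) / embed (\d_(repr r)).
Proof.
have nzd : embed (\d_(repr r)) != 0.
  by rewrite -(rmorph0 embed) (inj_eq embed_inj) denom_ratioP.
apply: (canRL (mulfK nzd)).
rewrite -{1}[r]reprK /= /tofrac; unlock.
rewrite -[LHS]FracField.pi_mul; apply/eqmodP => /=.
rewrite /FracField.equivf /FracField.mulf !numden_Ratio ?mulr1 ?mul1r //.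
  by rewrite mulrC.
all: by rewrite ?oner_eq0 ?denom_ratioP.
Qed.

(** Dominance keeps the denominator of the representative nonzero under substitution. Values being
    unique, composites can then be computed from any convenient expression of [r]. *)
Lemma rat_substP F r : dominant F -> specializes_at F r (rat_subst F r).
Proof.
move=> domF; exists (\n_(repr r)), (\d_(repr r)); split => //.
  by rewrite -(rmorph0 (poly_subst F)) (inj_eq domF) denom_ratioP.
exact: frac_repr.
Qed.

Lemma rat_substE F r u :
  dominant F -> specializes_at F r u -> rat_subst F r = u.
Proof.
by move=> domF; apply: (specializes_unique embed_inj); apply: rat_substP.
Qed.

(* A polynomial relation between the components of [G] would specialize at [F]
   to one between the variables. *)
Lemma dominant_of_section F G :
  (forall x, specializes_at F (G x) (X x)) -> dominant G.
Proof.
move=> GX p q epq; apply/eqP; rewrite -subr_eq0; apply/eqP/embed_inj.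
rewrite rmorph0 -poly_subst_id.
(* The relation [poly_subst G (p - q)] is zero, so its value at [F], which is [p - q] in the
   variables themselves, must be zero too. *)
apply: (specializes_unique (sigma := poly_subst F) embed_inj (r := 0));
  last exact: specializes0.
have <- : poly_subst G (p - q) = 0 by rewrite rmorphB /= epq subrr.
by apply: specializes_poly_subst => x; rewrite ffunE.
Qed.

(** Each hypothesis serves twice: it makes one of the two maps dominant and says that one of the two
    composites is the identity. *)
Lemma birational_of_inverse F G :
  (forall x, specializes_at F (G x) (X x)) ->
  (forall x, specializes_at G (F x) (X x)) ->
  birational F.
Proof.
move=> GX FX; have domG := dominant_of_section GX.
have domF := dominant_of_section FX.
split=> //; exists G; split=> //; apply/ffunP => x; rewrite !ffunE;
  exact: rat_substE.
Qed.

Lemma dominant_ratid : dominant (ratid P K).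
Proof.
apply: (@dominant_of_section (ratid P K)) => x.
by have := specializes_label (ratid P K) x; rewrite !ffunE.
Qed.

(** A relation between the components of the composite is the value at [F] of the same relation
    between those of [G]. It lifts because only zero takes the value zero at a dominant map. *)
Lemma dominant_comp F G : dominant G -> dominant F -> dominant (ratcomp G F).
Proof.
move=> domG domF p q epq; apply/eqP; rewrite -subr_eq0; apply/eqP/domG.
rewrite [RHS]rmorph0; apply: (specializes_inj0 domF).
have <- : poly_subst (ratcomp G F) (p - q) = 0.
  by rewrite rmorphB /= epq subrr.
by apply: specializes_poly_subst => x; rewrite ffunE; apply: rat_substP.
Qed.

Lemma ratmap_natr_neq0 n : [pchar K] =i pred0 -> n.+1%:R != 0 :> L.
Proof.
move=> charK; rewrite -(rmorph_nat (@ratconst P K)) fmorph_eq0.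
by have /pcharf0P -> := charK.
Qed.

End RationalMapTheory.

(** * Chain sums *)

Section MaximalChains.
Variables (d : Order.disp_t) (P : finPOrderType d).
Implicit Types (A B S : {set P}).

(** Maximality is tested one element at a time, and relative to [S], so that the parts of a chain
    below and above an element can be treated separately. *)
Definition max_chain_in S A :=
  [&& A \subset S, chain A
    & [forall z in S, [forall a in A, (z >=< a)%O] ==> (z \in A)]].

Lemma chainP A : reflect {in A &, forall x y, (x >=< y)%O} (chain A).
Proof.
apply: (iffP forall_inP) => [cA x y xA yA|cA x xA].
  by have /forall_inP := cA x xA; apply.
by apply/forall_inP => y; apply: cA.
Qed.

Lemma max_chain_inP S A :
  reflect [/\ {subset A <= S}, {in A &, forall x y, (x >=< y)%O}
            & forall z, z \in S -> {in A, forall a, (z >=< a)%O} -> z \in A]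
          (max_chain_in S A).
Proof.
apply: (iffP and3P) => -[/subsetP sAS /chainP cA mA]; split=> //.
- move=> z zS zA; have /forall_inP/(_ z zS)/implyP := mA; apply.
  exact/forall_inP.
- by apply/forall_inP => z zS; apply/implyP => /forall_inP; apply: mA.
Qed.

Lemma maxset_chain A : maxset (@chain d P) A = max_chain_in setT A.
Proof.
apply/maxsetP/max_chain_inP => [[/chainP cA mA]|[_ cA mA]]; split=> //.
- move=> z _ zA; suff <- : z |: A = A by rewrite setU11.
  apply: mA; last exact: subsetUr.
  apply/chainP => x y; rewrite !inE => /predU1P[->|xA] /predU1P[->|yA] //.
  + exact: comparablexx.
  + exact: zA.
  + by rewrite comparable_sym; apply: zA.
  + exact: cA.
- exact/chainP.
- move=> B /chainP cB sAB; apply/eqP; rewrite eqEsubset sAB andbT.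
  apply/subsetP => z zB; apply: mA; rewrite ?inE // => a aA.
  by apply: cB => //; apply: (subsetP sAB).
Qed.

End MaximalChains.

(** * Recursion for sums over maximal chains on one side of an element *)

Section ChainSums.
Variables (d : Order.disp_t) (P : finPOrderType d) (L : fieldType).
(* Either [<] or [>]: the two directions are treated at once. *)
Variable r : rel P.
Hypothesis r_irr : irreflexive r.
Hypothesis r_trans : transitive r.
Hypothesis r_comparable : forall x y, (x >=< y)%O = [|| x == y, r x y | r y x].
Implicit Types (A B S : {set P}) (g : P -> L).

Definition below v : {set P} := [set w | r w v].

Definition rcovered w v := r w v && [forall z, ~~ (r w z && r z v)].

Definition chain_sum_below g v : L :=
  \sum_(A : {set P} | max_chain_in (below v) A) \prod_(y in A) g y.

(** This is the inverse of nabla for [<] and the inverse of Delta for [>], with saturated chains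
    encoded as sets, as in the antichain toggle. *)
Definition chain_sum_to g v : L :=
  \sum_(A : {set P} | max_chain_in (v |: below v) A) \prod_(y in A) g y.

Lemma card_below_ltn w v : r w v -> (#|below w| < #|below v|)%N.
Proof.
move=> rwv; apply/proper_card/properP; split.
  by apply/subsetP => z; rewrite !inE => /r_trans; apply.
by exists w; rewrite !inE ?r_irr.
Qed.

Lemma below_ind (Q : P -> Prop) :
  (forall v, (forall w, r w v -> Q w) -> Q v) -> forall v, Q v.
Proof.
move=> IH v; have [n] := ubnP #|below v|; elim: n => // n IHn in v * => ltv.
apply: IH => w /card_below_ltn ltwv; apply: IHn.
exact: leq_trans ltwv _.
Qed.

(** Among the elements below [v], one with the most elements below itself leaves no room in
    between. *)
Lemma exists_rcovered v : below v != set0 -> exists w, rcovered w v.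
Proof.
case/set0Pn => w0; rewrite inE => rw0v.
case: (@arg_maxnP _ w0 (r^~ v) (fun w => #|below w|) rw0v) => w rwv max_w.
exists w; rewrite /rcovered rwv; apply/forallP => z; apply/andP => -[rwz rzv].
by have := max_w z rzv; rewrite /= leqNgt card_below_ltn.
Qed.

Lemma chain_top A : A != set0 -> {in A &, forall x y, (x >=< y)%O} ->
  exists2 w, w \in A & {in A, forall a, a \in w |: below w}.
Proof.
case/set0Pn => w0 w0A cA.
case: (@arg_maxnP _ w0 (mem A) (fun w => #|below w|) w0A) => w wA max_w.
exists w => // a aA; rewrite !inE.
have := cA a w aA wA; rewrite r_comparable; case/or3P=> [->|->|rwa] //.
  by rewrite orbT.
by have := max_w a aA; rewrite /= leqNgt card_below_ltn.
Qed.

Lemma below_notin v A : {subset A <= below v} -> v \notin A.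
Proof. by move=> sA; apply/negP => /sA; rewrite inE r_irr. Qed.

(** Since [v] is comparable with everything in [v |: below v], adjoining it affects neither the
    chain condition nor maximality. *)
Lemma max_chain_setU1 v B : {subset B <= below v} ->
  max_chain_in (v |: below v) (v |: B) = max_chain_in (below v) B.
Proof.
move=> sB; have vB := below_notin sB.
apply/max_chain_inP/max_chain_inP => -[sAS cA mA]; split=> //.
- by move=> x y xB yB; apply: cA; rewrite inE ?xB ?yB orbT.
- move=> z zv zB; have : z \in v |: B.
    apply: mA; first by rewrite inE zv orbT.
    move=> a; rewrite !inE => /predU1P[->|/zB //].
    by move: zv; rewrite inE r_comparable => ->; rewrite orbT.
  rewrite !inE => /predU1P[zv'|//].
  by move: zv; rewrite zv' inE r_irr.
- by move=> x; rewrite !inE => /predU1P[->|/sB]; rewrite ?eqxx // inE => ->;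
    rewrite orbT.
- move=> x y; rewrite !inE => /predU1P[->|xB] /predU1P[->|yB] //.
  + exact: comparablexx.
  + by have := sB _ yB; rewrite inE r_comparable => ->; rewrite !orbT.
  + by have := sB _ xB; rewrite inE r_comparable => ->; rewrite !orbT.
  + exact: cA.
- move=> z; rewrite !inE => /predU1P[->|rzv]; first by rewrite eqxx.
  move=> zA; rewrite mA ?orbT ?inE // => a aB; apply: zA.
  by rewrite inE aB orbT.
Qed.

Lemma max_chain_to_in v A : max_chain_in (v |: below v) A -> v \in A.
Proof.
case/max_chain_inP => sA _; apply; first by rewrite setU11.
move=> a /sA; rewrite !inE r_comparable eq_sym => /predU1P[->|->].
  by rewrite eqxx.
by rewrite !orbT.
Qed.

Lemma chain_sum_toE g v : chain_sum_to g v = g v * chain_sum_below g v.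
Proof.
rewrite /chain_sum_to.
rewrite (reindex_onto (fun B => v |: B) (fun A => A :\ v)) /=; last first.
  by move=> A /max_chain_to_in vA; rewrite setD1K.
rewrite /chain_sum_below big_distrr /=.
have E B : max_chain_in (v |: below v) (v |: B) && ((v |: B) :\ v == B) =
           max_chain_in (below v) B.
  apply/andP/idP => [[mB /eqP eB]|mB].
    have vB : v \notin B by rewrite -eB !inE eqxx.
    rewrite -max_chain_setU1 // => x xB.
    have [+ _ _] := max_chain_inP _ _ mB => /(_ x); rewrite !inE xB orbT.
    by case/(_ isT)/predU1P=> // xv; rewrite -xv xB in vB.
  have [sB _ _] := max_chain_inP _ _ mB; rewrite max_chain_setU1 //.
  by split=> //; rewrite setU1K // below_notin.
rewrite (eq_bigl _ _ E); apply: eq_bigr => B.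
by case/max_chain_inP => sB _ _; rewrite big_setU1 // below_notin.
Qed.

(** Maximal chains below [v] are sorted by their top element, which [v] covers; those with top [w]
    are the maximal chains ending at [w]. If nothing lies below [v], only the empty chain remains,
    with product 1. *)
Lemma chain_sum_belowE g v : chain_sum_below g v =
  (if below v == set0 then 1 else 0) + \sum_(w | rcovered w v) chain_sum_to g w.
Proof.
rewrite /chain_sum_below; case: eqP => [v0|/eqP v0].
  rewrite [X in _ + X]big1 => [|w /andP[rwv _]]; last first.
    have : w \in below v by rewrite inE.
    by rewrite v0 inE.
  rewrite (big_pred1 set0) => [|A]; first by rewrite big_set0 addr0.
  apply/max_chain_inP/eqP => [[sA _ _]|->]; last first.
    by split=> x; rewrite ?v0 inE.
  by apply/eqP; rewrite -subset0; apply/subsetP => x /sA; rewrite v0.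
rewrite add0r.
(* The default [v] is never returned on a nonempty chain. *)
pose top A := odflt v [pick w in A | [forall a in A, a \in w |: below w]].
have topP A : A != set0 -> chain A ->
    top A \in A /\ {in A, forall a, a \in top A |: below (top A)}.
  move=> A0 /chainP cA; rewrite /top; case: pickP => [w /andP[wA /forall_inP]|].
    by [].
  have [w wA wP] := chain_top A0 cA => /(_ w); rewrite /= wA /=.
  by move/forall_inP.
have top_uniq A w w' : w \in A -> w' \in A ->
   {in A, forall a, a \in w |: below w} ->
   {in A, forall a, a \in w' |: below w'} -> w = w'.
  move=> wA w'A wP w'P; have := wP _ w'A; rewrite !inE => /predU1P[->//|rw'w].
  have := w'P _ wA; rewrite !inE => /predU1P[->//|rww'].
  by have := r_trans rw'w rww'; rewrite r_irr.
have mx_neq0 A : max_chain_in (below v) A -> A != set0.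
  case/max_chain_inP => _ _ mA; have /set0Pn[z zv] := v0.
  apply/eqP => A0; have : z \in A by apply: mA => // a; rewrite A0 inE.
  by rewrite A0 inE.
rewrite (partition_big top (rcovered^~ v)) /=.
  apply: eq_bigr => w /andP[rwv /forallP covwv]; apply: eq_bigl => A.
  apply/andP/idP => [[mA /eqP tA]|mA].
    have A0 := mx_neq0 _ mA; case/max_chain_inP: mA => sA cA mA.
    have [] := topP A A0 (introT (chainP _) cA); rewrite tA => wA wP.
    apply/max_chain_inP; split=> // z; rewrite !inE => /predU1P[->//|rzw].
    by move=> zA; apply: mA => //; rewrite inE (r_trans rzw).
  have wA := max_chain_to_in mA.
  case/max_chain_inP: mA => sA cA mA; split.
    apply/max_chain_inP; split=> // [x /sA|z].
      by rewrite !inE => /predU1P[->//|/r_trans]; apply.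
    rewrite inE => rzv zA; apply: mA => //; rewrite !inE.
    have := zA w wA; rewrite r_comparable => /or3P[->|->|rwz] //.
      by rewrite orbT.
    by have := covwv z; rewrite rwz rzv.
  have A0 : A != set0 by apply/set0Pn; exists w.
  have [tA tP] := topP A A0 (introT (chainP _) cA).
  by apply/eqP; apply: (top_uniq A).
(* The top is covered by [v]: an element strictly between would be comparable with all of [A], hence
   belong to [A], above its top. *)
move=> A mA; have A0 := mx_neq0 _ mA; case/max_chain_inP: mA => sA cA mA.
have [tA tP] := topP A A0 (introT (chainP _) cA).
have := sA _ tA; rewrite inE /rcovered => rtv; rewrite rtv.
apply/forallP => z; apply/andP => -[rtz rzv].
have zA : z \in A.
  apply: mA; rewrite ?inE // => a /tP; rewrite !inE => /predU1P[->|rat].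
    by rewrite r_comparable rtz !orbT.
  by rewrite r_comparable (r_trans rat rtz) !orbT.
have := tP z zA; rewrite !inE => /predU1P[zt|rzt].
  by rewrite zt r_irr in rtz.
by have := r_trans rtz rzt; rewrite r_irr.
Qed.

Lemma eq_chain_sum_to g g' v :
  {in v |: below v, g =1 g'} -> chain_sum_to g v = chain_sum_to g' v.
Proof.
move=> gg'; apply: eq_bigr => A /max_chain_inP[sA _ _].
by apply: eq_bigr => y /sA/gg'.
Qed.

Lemma eq_chain_sum_below g g' v :
  {in below v, g =1 g'} -> chain_sum_below g v = chain_sum_below g' v.
Proof.
move=> gg'; apply: eq_bigr => A /max_chain_inP[sA _ _].
by apply: eq_bigr => y /sA/gg'.
Qed.

End ChainSums.

(** * Chain sums for the two directions of the order, and chains through an element *)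

Section PosetChainSums.
Variables (d : Order.disp_t) (P : finPOrderType d) (L : fieldType).
Implicit Types (A B : {set P}) (f g : P -> L) (v w x : P).

Definition lt_rel : rel P := fun x y => (x < y)%O.
Definition gt_rel : rel P := fun x y => (y < x)%O.

Lemma lt_rel_irr : irreflexive lt_rel. Proof. exact: ltxx. Qed.
Lemma gt_rel_irr : irreflexive gt_rel. Proof. exact: ltxx. Qed.
Lemma lt_rel_trans : transitive lt_rel. Proof. exact: lt_trans. Qed.
Lemma gt_rel_trans : transitive gt_rel.
Proof. by move=> y x z yx zy; apply: lt_trans yx. Qed.

Lemma lt_rel_comparable x y :
  (x >=< y)%O = [|| x == y, lt_rel x y | lt_rel y x].
Proof. by rewrite /lt_rel; case: comparableP. Qed.

Lemma gt_rel_comparable x y :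
  (x >=< y)%O = [|| x == y, gt_rel x y | gt_rel y x].
Proof. by rewrite lt_rel_comparable [lt_rel x y || _]orbC. Qed.

Lemma big_hat (Q : pred (hat P)) (F : hat P -> L) v :
  \sum_(y | Q y) F y = (if Q hat0 then F hat0 else 0) +
     (if Q hat1 then F hat1 else 0) + \sum_(w | Q (inhat w)) F (inhat w).
Proof.
rewrite big_mkcond (bigD1 hat0) //= (bigD1 hat1) //= addrA; congr (_ + _).
rewrite [RHS]big_mkcond.
(* The inverse of [inhat] needs a default in [P] at [hat0] and [hat1], whose terms have already been
   split off; [v] provides it. *)
rewrite (reindex_onto inhat (fun y => odflt v (odflt None y))) /=; last first.
  by move=> [[w|]|].
by apply: eq_bigl => w; rewrite /= eqxx.
Qed.

Lemma covered_inhat v w : covered (inhat v) (inhat w) = covered v w.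
Proof.
rewrite /covered; congr (_ && _); apply/forallP/forallP => h z.
  exact: h (inhat z).
by case: z => [[z|]|] //; apply: h.
Qed.

Lemma rcovered_gt v w : rcovered gt_rel w v = covered (inhat v) (inhat w).
Proof.
rewrite covered_inhat /covered; congr (_ && _).
by apply: eq_forallb => z; rewrite andbC.
Qed.

Lemma covered_hat0 v : covered hat0 (inhat v) = (below lt_rel v == set0).
Proof.
apply/idP/eqP => [/andP[_ /forallP h]|v0].
  by apply/setP => z; rewrite !inE; apply/negbTE; have := h (inhat z).
apply/andP; split=> //; apply/forallP => -[[z|]|] //.
apply/negP => /andP[_ zv]; have /setP/(_ z) := v0; rewrite !inE.
by move/negbT/negP; apply.
Qed.

Lemma covered_hat1 v : covered (inhat v) hat1 = (below gt_rel v == set0).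
Proof.
apply/idP/eqP => [/andP[_ /forallP h]|v0].
  apply/setP => z; rewrite !inE; apply/negbTE; have := h (inhat z).
  by rewrite andbT.
apply/andP; split=> //; apply/forallP => -[[z|]|] //.
apply/negP => /andP[vz _]; have /setP/(_ z) := v0; rewrite !inE.
by move/negbT/negP; apply.
Qed.

Lemma sum_lower_covers (F : hat P -> L) v :
  \sum_(y : hat P | covered y (inhat v)) F y =
  (if below lt_rel v == set0 then F hat0 else 0) +
  \sum_(w | rcovered lt_rel w v) F (inhat w).
Proof.
rewrite (big_hat _ _ v) covered_hat0 addr0.
by congr (_ + _); apply: eq_bigl => w; rewrite covered_inhat.
Qed.

Lemma sum_upper_covers (F : hat P -> L) v :
  \sum_(y : hat P | covered (inhat v) y) F y =
  (if below gt_rel v == set0 then F hat1 else 0) +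
  \sum_(w | rcovered gt_rel w v) F (inhat w).
Proof.
rewrite (big_hat _ _ v) covered_hat1 add0r.
by congr (_ + _); apply: eq_bigl => w; rewrite rcovered_gt.
Qed.

Definition nabla_inv f := chain_sum_to lt_rel f.

(** The empty chain, present exactly when [v] is minimal, matches the label 1 of [hat0]. *)
Lemma chain_sum_below_lt f v : chain_sum_below lt_rel f v =
  \sum_(y : hat P | covered y (inhat v)) hat_label 1 1 (nabla_inv f) y.
Proof.
rewrite sum_lower_covers.
exact: (chain_sum_belowE lt_rel_irr lt_rel_trans lt_rel_comparable).
Qed.

Lemma chain_sum_below_gt f v : chain_sum_below gt_rel f v =
  \sum_(y : hat P | covered (inhat v) y)
    hat_label 1 1 (chain_sum_to gt_rel f) y.
Proof.
rewrite sum_upper_covers.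
exact: (chain_sum_belowE gt_rel_irr gt_rel_trans gt_rel_comparable).
Qed.

Lemma nabla_invE f v : nabla_inv f v = f v *
  \sum_(y : hat P | covered y (inhat v)) hat_label 1 1 (nabla_inv f) y.
Proof.
rewrite -chain_sum_below_lt.
exact: (chain_sum_toE lt_rel_irr lt_rel_comparable).
Qed.

(** Elements below [v] are comparable with elements above [v] by transitivity, so the two halves of
    a chain through [v] impose no condition on each other. *)
Lemma max_chain_split v (B B' : {set P}) :
  {subset B <= below lt_rel v} -> {subset B' <= below gt_rel v} ->
  max_chain_in setT (v |: (B :|: B')) =
  max_chain_in (below lt_rel v) B && max_chain_in (below gt_rel v) B'.
Proof.
move=> sB sB'.
have ltB x : x \in B -> (x < v)%O by move/sB; rewrite inE.
have gtB' x : x \in B' -> (v < x)%O by move/sB'; rewrite inE.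
apply/max_chain_inP/andP => [[_ cA mA]|
    [/max_chain_inP[_ cB mB] /max_chain_inP[_ cB' mB']]].
  split; apply/max_chain_inP; split=> //.
  - by move=> x y xB yB; apply: cA; rewrite !inE ?xB ?yB !orbT.
  - move=> z; rewrite inE => zv zB.
    have : z \in v |: (B :|: B').
      apply: mA => // a; rewrite !inE => /or3P[/eqP->|/zB//|/gtB' va].
        exact: lt_comparable.
      exact/lt_comparable/(lt_trans zv).
    rewrite !inE => /or3P[/eqP zv'|//|/gtB' vz].
      by rewrite zv' /lt_rel ltxx in zv.
    by have := lt_trans zv vz; rewrite ltxx.
  - by move=> x y xB yB; apply: cA; rewrite !inE ?xB ?yB !orbT.
  - move=> z; rewrite inE => vz zB.
    have : z \in v |: (B :|: B').
      apply: mA => // a; rewrite !inE => /or3P[/eqP->|/ltB av|/zB//].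
        exact: gt_comparable.
      exact/gt_comparable/(lt_trans av).
    rewrite !inE => /or3P[/eqP zv'|/ltB zv|//].
      by rewrite zv' /gt_rel ltxx in vz.
    by have := lt_trans zv vz; rewrite ltxx.
split=> //.
  move=> x y; rewrite !inE.
  case/or3P=> [/eqP->|xB|xB'] /or3P[/eqP->|yB|yB'].
  - exact: comparablexx.
  - exact/gt_comparable/ltB.
  - exact/lt_comparable/gtB'.
  - exact/lt_comparable/ltB.
  - exact: cB.
  - exact/lt_comparable/(lt_trans (ltB _ xB))/gtB'.
  - exact/gt_comparable/gtB'.
  - exact/gt_comparable/(lt_trans (ltB _ yB))/gtB'.
  - exact: cB'.
move=> z _ zA; rewrite !inE.
have := zA v; rewrite !inE eqxx lt_rel_comparable => /(_ isT).
case/or3P=> [->//|zv|vz]; apply/orP; right; apply/orP; [left|right].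
  by apply: mB => [|a aB]; rewrite ?inE //; apply: zA; rewrite !inE aB orbT.
by apply: mB' => [|a aB]; rewrite ?inE //; apply: zA; rewrite !inE aB !orbT.
Qed.

(** Cutting a maximal chain at [v] is a bijection onto pairs of maximal chains below and above [v],
    and the sum over pairs factors. *)
Lemma sum_max_chains_through g v :
  \sum_(A : {set P} | maxset (@chain d P) A && (v \in A)) \prod_(y in A) g y =
  g v * (chain_sum_below lt_rel g v * chain_sum_below gt_rel g v).
Proof.
rewrite /chain_sum_below big_distrlr /= pair_big_dep /= big_distrr /=.
pose h (p : {set P} * {set P}) := v |: (p.1 :|: p.2).
pose h' A := (A :&: below lt_rel v, A :&: below gt_rel v).
have h'K A : chain A -> v \in A -> h (h' A) = A.
  move=> /chainP cA vA; apply/setP => x; rewrite !inE /=.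
  apply/idP/idP => [/or3P[/eqP->|/andP[]|/andP[]]//|xA].
  have := cA x v xA vA; rewrite lt_rel_comparable.
  by rewrite xA /= /gt_rel /lt_rel; case/or3P => ->; rewrite ?orbT.
rewrite (reindex_onto h h') /=; last first.
  by move=> A /andP[/maxsetP[cA _] vA]; apply: h'K.
have E p : [&& maxset (@chain d P) (h p), v \in h p & h' (h p) == p] =
  max_chain_in (below lt_rel v) p.1 && max_chain_in (below gt_rel v) p.2.
  case: p => B B'; rewrite maxset_chain; apply/and3P/idP => /= [[mA _]|mB].
    rewrite /h' xpair_eqE => /andP[/eqP eB /eqP eB'].
    by rewrite -max_chain_split // => x; [rewrite -eB|rewrite -eB']; case/setIP.
  have [sB sB'] : {subset B <= below lt_rel v} /\ {subset B' <= below gt_rel v}.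
    by case/andP: mB => /max_chain_inP[? _ _] /max_chain_inP[].
  rewrite /h /= max_chain_split // setU11; split=> //.
  rewrite /h' xpair_eqE; apply/andP; split; apply/eqP/setP => x; rewrite !inE.
    apply/andP/idP => [[/or3P[/eqP->|//|/sB']]|xB];
      rewrite ?inE /lt_rel ?ltxx //.
      by move=> vx xv; have := lt_trans vx xv; rewrite ltxx.
    by rewrite xB orbT; split=> //; have := sB _ xB; rewrite inE.
  apply/andP/idP => [[/or3P[/eqP->|/sB|//]]|xB]; rewrite ?inE /gt_rel ?ltxx //.
    by move=> vx xv; have := lt_trans vx xv; rewrite ltxx.
  by rewrite xB !orbT; split=> //; have := sB' _ xB; rewrite inE.
under eq_bigl => p do rewrite -andbA.
rewrite (eq_bigl _ _ E); apply: eq_bigr => -[B B'] /=.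
case/andP=> /max_chain_inP[sB _ _] /max_chain_inP[sB' _ _].
have dB : [disjoint B & B'].
  apply/pred0P => x /=; apply/negP => /andP[/sB + /sB'].
  by rewrite !inE => xv vx; have := lt_trans vx xv; rewrite ltxx.
have vB : v \notin B :|: B'.
  rewrite inE negb_or (below_notin lt_rel_irr sB).
  exact: (below_notin gt_rel_irr sB').
rewrite /h (big_setU1 _ vB) (eq_bigl [predU B & B']) ?bigU // => x.
by rewrite !inE.
Qed.

Definition upper_chain_sum f k x : L :=
  \sum_(s : k.-tuple P |
      (ohead s == Some x)
      && sorted (@covered _ (hat P)) (rcons (map inhat s) hat1))
    \prod_(y <- s) f y.

Lemma upper_chain_sum0 f x : upper_chain_sum f 0 x = 0.
Proof. by rewrite /upper_chain_sum big_pred0 // => s; rewrite tuple0. Qed.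

(** Removing the first element [x] leaves either nothing, which requires [x] to be maximal, or a
    chain starting at an upper cover of [x]. *)
Lemma upper_chain_sumS f k x : upper_chain_sum f k.+1 x = f x *
  ((if (k == 0%N) && (below gt_rel x == set0) then 1 else 0) +
   \sum_(w | rcovered gt_rel w x) upper_chain_sum f k w).
Proof.
rewrite /upper_chain_sum.
pose h (p : P * k.-tuple P) := [tuple of p.1 :: p.2].
rewrite (reindex h) /=; last first.
  exists (fun s : k.+1.-tuple P => (thead s, [tuple of behead s])).
    by move=> [y s] _; congr (_, _); apply: val_inj.
  by move=> s _; rewrite [RHS]tuple_eta.
rewrite -(pair_big_dep xpredT (fun y (s : k.-tuple P) => (Some y == Some x) &&
  path (@covered _ (hat P)) (inhat y) (rcons (map inhat s) hat1))
  (fun y s => \prod_(z <- y :: s) f z)) /=.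
rewrite (bigD1 x) //= [X in _ + X]big1 ?addr0; last first.
  move=> y yx; rewrite big_pred0 // => s.
  by rewrite (inj_eq Some_inj) (negPf yx).
under eq_bigr do rewrite big_cons.
rewrite -big_distrr /=; congr (_ * _).
(* With the tail [s] as outer index, at most one [w] contributes, namely the head of [s]. *)
rewrite eqxx /= (exchange_big_dep predT) //= big_mkcond.
case: k h => [|k] _ /=.
  rewrite !(big_pred1 [tuple]) => [|s|s]; rewrite ?[s]tuple0 //=.
  rewrite andbT covered_hat1 big_nil big_pred0 ?addr0 // => w.
  by rewrite andbF.
rewrite add0r; apply: eq_bigr => s _; case/tupleP: s => y s /=.
rewrite -rcovered_gt; case: ifP => [/andP[cxy ps]|ncps].
  rewrite (big_pred1 y) // => w; rewrite ps andbT (inj_eq Some_inj).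
  by rewrite /= [w == y]eq_sym; case: eqP => [<-|]; rewrite ?andbF ?andbT.
rewrite big_pred0 // => w; rewrite (inj_eq Some_inj).
by case: eqP => [<-|]; rewrite ?andbF.
Qed.

Lemma Delta_inv_formulaE f : Delta_inv_formula f =1 chain_sum_to gt_rel f.
Proof.
move=> x.
have -> : Delta_inv_formula f x =
    \sum_(k < #|P|.+1) upper_chain_sum f k x by [].
have : (#|below gt_rel x| < #|P|)%N.
  rewrite -cardsT; apply/proper_card/properP; split; first exact: subsetT.
  by exists x; rewrite // inE gt_rel_irr.
(* The length bound is generalized from [#|P|] to any number exceeding the count of elements above
   [x]; that count drops at each upper cover, just as the bound does. *)
elim: #|P| x => // n IHn x ltx.
rewrite big_ord_recl upper_chain_sum0 add0r.
under eq_bigr do rewrite upper_chain_sumS.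
rewrite -big_distrr /= big_split /= exchange_big /=.
rewrite (chain_sum_toE gt_rel_irr gt_rel_comparable).
rewrite (chain_sum_belowE gt_rel_irr gt_rel_trans gt_rel_comparable).
congr (_ * (_ + _)); last first.
  apply: eq_bigr => w /andP[rwx _]; apply: IHn.
  by have := card_below_ltn gt_rel_irr gt_rel_trans rwx => /leq_trans; apply.
by rewrite big_ord_recl /= big1 ?addr0.
Qed.

Lemma Delta_invE f v : Delta_inv_formula f v = f v *
  \sum_(y : hat P | covered (inhat v) y) hat_label 1 1 (Delta_inv_formula f) y.
Proof.
rewrite Delta_inv_formulaE (chain_sum_toE gt_rel_irr gt_rel_comparable).
rewrite chain_sum_below_gt; congr (_ * _); apply: eq_bigr => -[[y|]|] //= _.
by rewrite Delta_inv_formulaE.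
Qed.

End PosetChainSums.

(** * The toggle and transfer formulas *)

Section FormulaAlgebra.
Variables (d : Order.disp_t) (P : finPOrderType d) (L : fieldType).
Implicit Types (C : L) (f g h : P -> L) (v w x : P).

Definition lower_sum f v : L :=
  \sum_(y : hat P | covered y (inhat v)) hat_label 1 1 f y.

Definition upper_sum f v : L :=
  \sum_(y : hat P | covered (inhat v) y) hat_label 1 1 f y.

Definition upper_inv_sum C f v : L :=
  \sum_(y : hat P | covered (inhat v) y) (hat_label 1 C f y)^-1.

Definition Delta_formula f x : L := f x / upper_sum f x.

(** The label of [hat1] may be changed freely, since [hat1] is never a lower cover. *)
Lemma lower_sumE C f v :
  \sum_(y : hat P | covered y (inhat v)) hat_label 1 C f y = lower_sum f v.
Proof. by rewrite /lower_sum !sum_lower_covers. Qed.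

Lemma eq_lower_sum f g v :
  (forall w, (w < v)%O -> f w = g w) -> lower_sum f v = lower_sum g v.
Proof.
move=> fg; rewrite /lower_sum !sum_lower_covers; congr (_ + _).
by apply: eq_bigr => w /andP[/fg].
Qed.

Lemma eq_upper_sum f g v :
  (forall w, (v < w)%O -> f w = g w) -> upper_sum f v = upper_sum g v.
Proof.
move=> fg; rewrite /upper_sum !sum_upper_covers; congr (_ + _).
by apply: eq_bigr => w /andP[/fg].
Qed.

Lemma eq_upper_inv_sum C f g v : (forall w, (v < w)%O -> f w = g w) ->
  upper_inv_sum C f v = upper_inv_sum C g v.
Proof.
move=> fg; rewrite /upper_inv_sum !sum_upper_covers; congr (_ + _).
by apply: eq_bigr => w /andP[/fg /= ->].
Qed.

Lemma order_toggleE C v f x : order_toggle_formula C v f x =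
  if x == v then lower_sum f v / (f v * upper_inv_sum C f v) else f x.
Proof. by rewrite /order_toggle_formula lower_sumE. Qed.

Lemma antichain_toggleE C v g x : antichain_toggle_formula C v g x =
  if x == v then
    C / (g v * (chain_sum_below (@lt_rel d P) g v *
                chain_sum_below (@gt_rel d P) g v))
  else g x.
Proof. by rewrite /antichain_toggle_formula sum_max_chains_through. Qed.

(** Both toggles replace the label b at [v] by a / (b c), where a and c do not depend on b; this is
    why they are involutions. *)
Lemma toggle_div_cancel (a b c : L) : a != 0 -> c != 0 ->
  a / (a / (b * c) * c) = b.
Proof.
by move=> a0 c0; rewrite [(b * c)^-1]invfM mulrA divfK // invf_div mulrC divfK.
Qed.

Lemma order_toggleK C v f :
  lower_sum f v != 0 -> upper_inv_sum C f v != 0 ->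
  order_toggle_formula C v (order_toggle_formula C v f) =1 f.
Proof.
move=> nzl nzu x; rewrite !order_toggleE eqxx; case: eqP => [->|//].
rewrite (@eq_lower_sum _ f) => [|w wv]; last first.
  by rewrite order_toggleE (lt_eqF wv).
rewrite (@eq_upper_inv_sum _ _ f) => [|w vw]; last first.
  by rewrite order_toggleE (gt_eqF vw).
exact: toggle_div_cancel.
Qed.

Lemma antichain_toggleK C v g : C != 0 ->
  chain_sum_below (@lt_rel d P) g v != 0 ->
  chain_sum_below (@gt_rel d P) g v != 0 ->
  antichain_toggle_formula C v (antichain_toggle_formula C v g) =1 g.
Proof.
move=> nzC nzl nzu x; rewrite !antichain_toggleE eqxx; case: eqP => [->|//].
rewrite (@eq_chain_sum_below _ _ _ (@lt_rel d P) _ g) => [|w]; last first.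
  by rewrite inE antichain_toggleE => wv; rewrite (lt_eqF wv).
rewrite (@eq_chain_sum_below _ _ _ (@gt_rel d P) _ g) => [|w]; last first.
  by rewrite inE antichain_toggleE => vw; rewrite (gt_eqF vw).
by apply: toggle_div_cancel => //; apply: mulf_neq0.
Qed.

Lemma order_toggle_label_neq0 C v f y : C != 0 -> (forall x, f x != 0) ->
  covered (inhat v) y -> hat_label 1 C (order_toggle_formula C v f) y != 0.
Proof.
move=> nzC nzf; case: y => [[y|]|] //= /andP[vy _].
have {}vy : (v < y)%O by [].
by rewrite order_toggleE (gt_eqF vy).
Qed.

Lemma order_toggle_denom_neq0 C v f : f v != 0 -> lower_sum f v != 0 ->
  upper_inv_sum C f v != 0 ->
  order_toggle_formula C v f v
    * upper_inv_sum C (order_toggle_formula C v f) v != 0.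
Proof.
move=> nzf nzl nzu; rewrite (@eq_upper_inv_sum _ _ f) => [|w vw]; last first.
  by rewrite order_toggleE (gt_eqF vw).
by rewrite order_toggleE eqxx !mulf_neq0 ?invr_neq0 ?mulf_neq0.
Qed.

Lemma antichain_toggle_denom_neq0 C v g : C != 0 -> g v != 0 ->
  chain_sum_below (@lt_rel d P) g v != 0 ->
  chain_sum_below (@gt_rel d P) g v != 0 ->
  antichain_toggle_formula C v g v *
    (chain_sum_below (@lt_rel d P) (antichain_toggle_formula C v g) v *
     chain_sum_below (@gt_rel d P) (antichain_toggle_formula C v g) v) != 0.
Proof.
move=> nzC nzg nzl nzu.
rewrite (@eq_chain_sum_below _ _ _ (@lt_rel d P) _ g) => [|w]; last first.
  by rewrite inE antichain_toggleE => wv; rewrite (lt_eqF wv).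
rewrite (@eq_chain_sum_below _ _ _ (@gt_rel d P) _ g) => [|w]; last first.
  by rewrite inE antichain_toggleE => vw; rewrite (gt_eqF vw).
by rewrite antichain_toggleE eqxx !mulf_neq0 ?invr_neq0 ?mulf_neq0.
Qed.

Lemma ThetaK C f : C != 0 -> Theta_formula C (Theta_formula C f) =1 f.
Proof. by move=> nzC x; rewrite /Theta_formula invf_div mulrC divfK. Qed.

Lemma Theta_neq0 C f x : C != 0 -> f x != 0 -> Theta_formula C f x != 0.
Proof. by move=> nzC nzf; rewrite /Theta_formula mulf_neq0 ?invr_neq0. Qed.

Lemma nabla_formulaE f x : nabla_formula f x = f x / lower_sum f x.
Proof. by []. Qed.

Lemma nabla_inv_sum f v : nabla_inv f v = f v * lower_sum (nabla_inv f) v.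
Proof. exact: nabla_invE. Qed.

Lemma nabla_invK f x : lower_sum (nabla_inv f) x != 0 ->
  nabla_formula (nabla_inv f) x = f x.
Proof. by move=> nz; rewrite nabla_formulaE nabla_inv_sum mulfK. Qed.

(** Induction from the bottom: once the labels below [v] are recovered, the recursion for
    [nabla_inv] multiplies back the sum that nabla divided by. *)
Lemma nablaK f : (forall x, lower_sum f x != 0) ->
  nabla_inv (nabla_formula f) =1 f.
Proof.
move=> nz; apply: (below_ind (@lt_rel_irr d P) (@lt_rel_trans d P)) => v IH.
rewrite nabla_inv_sum nabla_formulaE (eq_lower_sum (g := f)) ?divfK //.
Qed.

Lemma Delta_inv_sum f v :
  Delta_inv_formula f v = f v * upper_sum (Delta_inv_formula f) v.
Proof. exact: Delta_invE. Qed.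

Lemma Delta_invK f x : upper_sum (Delta_inv_formula f) x != 0 ->
  Delta_formula (Delta_inv_formula f) x = f x.
Proof. by move=> nz; rewrite /Delta_formula Delta_inv_sum mulfK. Qed.

Lemma DeltaK f : (forall x, upper_sum f x != 0) ->
  Delta_inv_formula (Delta_formula f) =1 f.
Proof.
move=> nz; apply: (below_ind (@gt_rel_irr d P) (@gt_rel_trans d P)) => v IH.
rewrite Delta_inv_sum /Delta_formula (eq_upper_sum (g := f)) ?divfK //.
Qed.

(** One step of the upward sweep. The label at [v] times the upper chain sum is
    [Delta_inv_formula f v], so dividing [C] by it gives [k v]; the lower chain sum supplies the
    denominator of nabla. *)
Lemma antichain_toggle_step C f g v :
  let k := Theta_formula C (Delta_inv_formula f) in
  (forall x, lower_sum k x != 0) ->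
  (forall w, (w < v)%O -> g w = nabla_formula k w) ->
  (forall w, (v <= w)%O -> g w = f w) ->
  antichain_toggle_formula C v g v = nabla_formula k v.
Proof.
move=> k nzk glt gge; rewrite antichain_toggleE eqxx nabla_formulaE.
rewrite [k v]/Theta_formula Delta_inv_formulaE.
rewrite (chain_sum_toE (@gt_rel_irr d P) (@gt_rel_comparable d P)).
have -> : chain_sum_below (@lt_rel d P) g v = lower_sum k v.
  rewrite chain_sum_below_lt -/(lower_sum _ _); apply: eq_lower_sum => w wv.
  (* The chain sum ending at [w] sees only labels at or below [w], where [g] is already nabla of
     [k]. *)
  rewrite -[RHS](nablaK nzk); apply: eq_chain_sum_to => u.
  rewrite !inE => /predU1P[->|uw]; apply: glt => //.
  exact: lt_trans wv.
rewrite (@eq_chain_sum_below _ _ _ (@gt_rel d P) g f) => [|w]; last first.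
  by rewrite inE => vw; apply/gge/ltW.
by rewrite gge // mulrCA [_ * (f v * _)]mulrC invfM mulrA.
Qed.

(** One step of the downward sweep: by the recursion for [D], [D v] is [f v] times the upper sum of
    [D], divided by the lower sum of [f]. *)
Lemma order_toggle_step C f g v :
  let D := Delta_inv_formula (nabla_formula f) in
  (forall w, (v < w)%O -> g w = C / D w) ->
  (forall w, (w <= v)%O -> g w = f w) ->
  order_toggle_formula C v g v = C / D v.
Proof.
move=> D ggt gle; rewrite order_toggleE eqxx /D Delta_inv_sum nabla_formulaE.
rewrite (@eq_lower_sum _ f) => [|w wv]; last exact/gle/ltW.
(* Inverting the labels C / D turns them into D / C; at [hat1] the label [C] against the convention
   1 gives the same factor. *)
have -> : upper_inv_sum C g v = upper_sum D v / C.
  rewrite /upper_sum /upper_inv_sum !sum_upper_covers mulrDl big_distrl /=.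
  congr (_ + _); first by case: ifP; rewrite ?mul1r ?mul0r.
  by apply: eq_bigr => w /andP[/ggt -> _]; rewrite invf_div.
rewrite gle //; set a := lower_sum f v; set b := upper_sum _ v.
by rewrite !invfM !invrK [LHS]mulrA [LHS]mulrA [LHS]mulrC [a * _]mulrC.
Qed.

End FormulaAlgebra.

(** * Compatibility of the toggle and transfer formulas with specialization *)

Section FormulaSpecialization.
Variables (d : Order.disp_t) (P : finPOrderType d).
Variables (R : idomainType) (L L' : fieldType).
Variables (iota : {rmorphism R -> L}) (sigma : {rmorphism R -> L'}).
Hypothesis iota_inj : injective iota.
Local Notation sp := (specializes iota sigma).
(** The first alternative serves composition with a map known to be dominant; the second serves the
    proofs that formulas are mutually inverse, from which dominance is deduced. *)
Local Notation safe u := (injective sigma \/ u != 0).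
Variables (f : P -> L) (f' : P -> L') (C : L) (C' : L').
Hypothesis spf : forall x, sp (f x) (f' x).
Hypothesis spC : sp C C'.

Lemma specializes_hat_label y : sp (hat_label 1 C f y) (hat_label 1 C' f' y).
Proof. by case: y => [[y|]|] //=; apply: specializes1. Qed.

Lemma specializes_hat_label1 y : sp (hat_label 1 1 f y) (hat_label 1 1 f' y).
Proof. by case: y => [[y|]|] //=; apply: specializes1. Qed.

Lemma specializes_lower_sum v : sp (lower_sum f v) (lower_sum f' v).
Proof. by apply: specializes_sum => // y _; apply: specializes_hat_label1. Qed.

Lemma specializes_upper_sum v : sp (upper_sum f v) (upper_sum f' v).
Proof. by apply: specializes_sum => // y _; apply: specializes_hat_label1. Qed.

Lemma specializes_upper_inv_sum v :
  (forall y, covered (inhat v) y -> safe (hat_label 1 C' f' y)) ->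
  sp (upper_inv_sum C f v) (upper_inv_sum C' f' v).
Proof.
move=> nz; apply: specializes_sum => // y cvy.
by apply: specializesV; [apply: nz | apply: specializes_hat_label].
Qed.

Lemma specializes_order_toggle v x :
  (forall y, covered (inhat v) y -> safe (hat_label 1 C' f' y)) ->
  safe (f' v * upper_inv_sum C' f' v) ->
  sp (order_toggle_formula C v f x) (order_toggle_formula C' v f' x).
Proof.
move=> nz nz'; rewrite !order_toggleE; case: eqP => // _.
apply: specializes_div => //; first exact: specializes_lower_sum.
by apply: specializesM => //; apply: specializes_upper_inv_sum.
Qed.

Lemma specializes_chain_sum_below r v :
  sp (chain_sum_below r f v) (chain_sum_below r f' v).
Proof.
by apply: specializes_sum => // A _; apply: specializes_prod => y _; apply: spf.
Qed.

Lemma specializes_chain_sum_to r v :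
  sp (chain_sum_to r f v) (chain_sum_to r f' v).
Proof.
by apply: specializes_sum => // A _; apply: specializes_prod => y _; apply: spf.
Qed.

Lemma specializes_antichain_toggle v x :
  safe (f' v * (chain_sum_below (@lt_rel d P) f' v *
                chain_sum_below (@gt_rel d P) f' v)) ->
  sp (antichain_toggle_formula C v f x) (antichain_toggle_formula C' v f' x).
Proof.
move=> nz; rewrite !antichain_toggleE; case: eqP => // _.
apply: specializes_div => //; apply: specializesM => //.
by apply: specializesM; apply: specializes_chain_sum_below.
Qed.

Lemma specializes_Theta x : safe (f' x) ->
  sp (Theta_formula C f x) (Theta_formula C' f' x).
Proof. by move=> nz; apply: specializes_div. Qed.

Lemma specializes_nabla x : safe (lower_sum f' x) ->
  sp (nabla_formula f x) (nabla_formula f' x).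
Proof.
by move=> nz; apply: specializes_div => //; apply: specializes_lower_sum.
Qed.

Lemma specializes_Delta x : safe (upper_sum f' x) ->
  sp (Delta_formula f x) (Delta_formula f' x).
Proof.
by move=> nz; apply: specializes_div => //; apply: specializes_upper_sum.
Qed.

Lemma specializes_Delta_inv x :
  sp (Delta_inv_formula f x) (Delta_inv_formula f' x).
Proof. by rewrite !Delta_inv_formulaE; apply: specializes_chain_sum_to. Qed.

End FormulaSpecialization.

(** * Nonvanishing of the denominators for positive labelings *)

Section PositiveSums.
Variables (d : Order.disp_t) (P : finPOrderType d).
Variables (R : idomainType) (L L' : fieldType).
Variables (iota : {rmorphism R -> L}) (sigma : {rmorphism R -> L'}).
Hypothesis iota_inj : injective iota.
Hypothesis natr_neq0 : forall n, n.+1%:R != 0 :> L'.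
Local Notation pos := (positive iota sigma).
Variable f : P -> L.
Hypothesis pos_f : forall x, pos (f x).

Lemma exists_lower_cover v : exists y : hat P, covered y (inhat v).
Proof.
have [v0|v0] := boolP (below (@lt_rel d P) v == set0).
  by exists hat0; rewrite covered_hat0.
have [w cwv] := exists_rcovered (@lt_rel_irr d P) (@lt_rel_trans d P) v0.
by exists (inhat w); rewrite covered_inhat.
Qed.

Lemma exists_upper_cover v : exists y : hat P, covered (inhat v) y.
Proof.
have [v0|v0] := boolP (below (@gt_rel d P) v == set0).
  by exists hat1; rewrite covered_hat1.
have [w cwv] := exists_rcovered (@gt_rel_irr d P) (@gt_rel_trans d P) v0.
by exists (inhat w); rewrite -rcovered_gt.
Qed.

Lemma positive_lower_sum v : pos (lower_sum f v).
Proof.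
have [y0 cy0] := exists_lower_cover v.
apply: (positive_sum (Q := fun y => covered y (inhat v)) iota_inj cy0).
by case=> [[y|]|] //= _; apply: positive1.
Qed.

Lemma positive_upper_sum v : pos (upper_sum f v).
Proof.
have [y0 cy0] := exists_upper_cover v.
apply: (positive_sum (Q := fun y => covered (inhat v) y) iota_inj cy0).
by case=> [[y|]|] //= _; apply: positive1.
Qed.

(* A maximal [v] has [hat1] as its only upper cover, so that [C] is never added
   to another label. *)
Lemma upper_inv_sum_neq0 C v : C != 0 -> upper_inv_sum C f v != 0.
Proof.
move=> nzC; rewrite /upper_inv_sum sum_upper_covers.
have [v0|v0] := eqVneq (below (@gt_rel d P) v) set0.
  rewrite big_pred0 ?addr0 ?invr_eq0 // => w; apply/negP => /andP[vw _].
  by have /setP/(_ w) := v0; rewrite !inE => /negP.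
rewrite add0r; apply: (positive_neq0 iota_inj natr_neq0).
have [w cwv] := exists_rcovered (@gt_rel_irr d P) (@gt_rel_trans d P) v0.
by apply: (positive_sum (Q := fun w => rcovered _ w v) iota_inj cwv) => y _;
  apply: (positiveV natr_neq0); apply: pos_f.
Qed.

End PositiveSums.

Section PositiveInverses.
Variables (d : Order.disp_t) (P : finPOrderType d).
Variables (R : idomainType) (L L' : fieldType).
Variables (iota : {rmorphism R -> L}) (sigma : {rmorphism R -> L'}).
Hypothesis iota_inj : injective iota.
Local Notation pos := (positive iota sigma).
Variable f : P -> L.
Hypothesis pos_f : forall x, pos (f x).

Lemma positive_nabla_inv x : pos (nabla_inv f x).
Proof.
elim/(below_ind (@lt_rel_irr d P) (@lt_rel_trans d P)): x => v IH.
(* The induction hypothesis covers only labels below [v], while [positive_lower_sum] wants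
   positivity everywhere; the value 1 elsewhere leaves the lower sum at [v] unchanged. *)
pose f' w := if (w < v)%O then nabla_inv f w else 1.
rewrite nabla_inv_sum (@eq_lower_sum _ _ _ _ f') => [|w wv]; last first.
  by rewrite /f' wv.
apply: positiveM => //; apply: positive_lower_sum => // w.
by rewrite /f'; case: ifP => [/IH//|_]; apply: positive1.
Qed.

Lemma positive_Delta_inv x : pos (Delta_inv_formula f x).
Proof.
elim/(below_ind (@gt_rel_irr d P) (@gt_rel_trans d P)): x => v IH.
pose f' w := if (v < w)%O then Delta_inv_formula f w else 1.
rewrite Delta_inv_sum (@eq_upper_sum _ _ _ _ f') => [|w vw]; last first.
  by rewrite /f' vw.
apply: positiveM => //; apply: positive_upper_sum => // w.
by rewrite /f'; case: ifP => [/IH//|_]; apply: positive1.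
Qed.

End PositiveInverses.

(** * Rowmotion *)

Section LinearExtensions.
Variables (d : Order.disp_t) (P : finPOrderType d).

(** Describes the state of a sweep on reaching [v]: read from the left, [s1] has been toggled; read
    from the right, [s2] has. *)
Lemma linear_extension_split (s1 s2 : seq P) v :
  linear_extension (s1 ++ v :: s2) ->
  [/\ forall w, (w < v)%O -> w \in s1, forall w, (v <= w)%O -> w \notin s1,
      forall w, (v < w)%O -> w \in s2 & forall w, (w <= v)%O -> w \notin s2].
Proof.
case=> us ms idx.
have [vs1 vs2] : v \notin s1 /\ v \notin s2.
  move: us; rewrite cat_uniq /= negb_or => /and3P[_ /andP[-> _] /andP[-> _]] //.
have idv : index v (s1 ++ v :: s2) = size s1.
  by rewrite index_cat (negPf vs1) /= eqxx addn0.
have lt1 w : (w < v)%O -> w \in s1.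
  move=> /idx; rewrite idv index_cat; case: ifP => // _.
  by rewrite ltnNge leq_addr.
have gt1 w : (v < w)%O -> w \notin s1.
  move=> /idx; rewrite idv index_cat; case: ifP => // ws1.
  by rewrite ltnNge ltnW // index_mem.
have disj w : w \in s1 -> w \notin s2.
  move=> ws1; move: us; rewrite cat_uniq => /and3P[_ /hasPn h _].
  apply/negP => ws2; have := h w; rewrite inE ws2 orbT ws1 => /(_ isT).
  by [].
split=> // w.
- by rewrite le_eqVlt => /predU1P[<-//|/gt1].
- move=> vw; have := ms w; rewrite mem_cat inE (negPf (gt1 w vw)) /=.
  by rewrite (gt_eqF vw).
- by rewrite le_eqVlt => /predU1P[->//|/lt1/disj].
Qed.

End LinearExtensions.

(** * Birationality of the maps, and the two rowmotion sweeps *)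

Section Birationality.
Variables (d : Order.disp_t) (P : finPOrderType d) (K : fieldType).
Hypothesis charK : [pchar K] =i pred0.
Variable C : K.
Hypothesis nzC : C != 0.
Local Notation L := (ratfun P K).
Local Notation X := (@generic_label P K).
Local Notation cC := (@ratconst P K C).
Implicit Types (F G : ratmap P K).

Lemma ratconst_neq0 : cC != 0.
Proof. by rewrite fmorph_eq0. Qed.

Let one : ratmap P K := [ffun=> 1].
Let pos := positive (@embed P K) (poly_subst one).

Lemma positive_label x : pos (X x).
Proof.
apply: positive_of_specializes1.
by have := specializes_label one x; rewrite ffunE.
Qed.

Lemma positive_ratfun_neq0 r : pos r -> r != 0.
Proof.
apply: (positive_neq0 (@embed_inj P K)) => n; exact: ratmap_natr_neq0.
Qed.

Lemma label_neq0 x : X x != 0.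
Proof. exact: positive_ratfun_neq0 (positive_label x). Qed.

Lemma lower_sum_label_neq0 v : lower_sum X v != 0.
Proof.
apply: positive_ratfun_neq0; apply: positive_lower_sum; first exact: embed_inj.
exact: positive_label.
Qed.

Lemma upper_sum_label_neq0 v : upper_sum X v != 0.
Proof.
apply: positive_ratfun_neq0; apply: positive_upper_sum; first exact: embed_inj.
exact: positive_label.
Qed.

Lemma upper_inv_sum_label_neq0 v : upper_inv_sum cC X v != 0.
Proof.
apply: (@upper_inv_sum_neq0 _ _ _ _ _ (@embed P K) (poly_subst one)).
- exact: embed_inj.
- move=> n; exact: ratmap_natr_neq0.
- exact: positive_label.
- exact: ratconst_neq0.
Qed.

Lemma lower_sum_nabla_inv_neq0 v : lower_sum (nabla_inv X) v != 0.
Proof.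
apply: positive_ratfun_neq0; apply: positive_lower_sum; first exact: embed_inj.
by apply: positive_nabla_inv; [apply: embed_inj | apply: positive_label].
Qed.

Lemma upper_sum_Delta_inv_neq0 v : upper_sum (Delta_inv_formula X) v != 0.
Proof.
apply: positive_ratfun_neq0; apply: positive_upper_sum; first exact: embed_inj.
by apply: positive_Delta_inv; [apply: embed_inj | apply: positive_label].
Qed.

Lemma chain_sum_below_lt_neq0 v : chain_sum_below (@lt_rel d P) X v != 0.
Proof. by rewrite chain_sum_below_lt; apply: lower_sum_nabla_inv_neq0. Qed.

Lemma chain_sum_below_gt_neq0 v : chain_sum_below (@gt_rel d P) X v != 0.
Proof.
rewrite chain_sum_below_gt -/(upper_sum _ _).
rewrite -(@eq_upper_sum _ _ _ (Delta_inv_formula X)).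
  exact: upper_sum_Delta_inv_neq0.
by move=> w _; apply: Delta_inv_formulaE.
Qed.

Lemma specializes_ratmap_of (Phi : (P -> L) -> P -> L) x :
  specializes_at (ratmap_of Phi) (X x) (Phi X x).
Proof. by have := specializes_label (ratmap_of Phi) x; rewrite ffunE. Qed.

Lemma birational_order_toggle v : birational (order_toggle C v : ratmap P K).
Proof.
have self x : specializes_at (order_toggle C v) (order_toggle C v x) (X x).
  rewrite [order_toggle C v x]ffunE.
  (* The expected value [X x] is written as the toggle formula applied to the toggled labeling, the
     form that specialization of a formula produces. *)
  rewrite -[X in specializes_at _ _ X](order_toggleK (C := cC) (v := v)
    (lower_sum_label_neq0 v) (upper_inv_sum_label_neq0 v) x).
  apply: specializes_order_toggle.
  - exact: embed_inj.
  - exact: specializes_ratmap_of.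
  - exact: specializes_const.
  - move=> y cvy; right; apply: order_toggle_label_neq0 cvy.
      exact: ratconst_neq0.
    exact: label_neq0.
  - right; apply: order_toggle_denom_neq0.
    + exact: label_neq0.
    + exact: lower_sum_label_neq0.
    + exact: upper_inv_sum_label_neq0.
exact: (birational_of_inverse self self).
Qed.

Lemma birational_antichain_toggle v :
  birational (antichain_toggle C v : ratmap P K).
Proof.
have self x :
    specializes_at (antichain_toggle C v) (antichain_toggle C v x) (X x).
  rewrite [antichain_toggle C v x]ffunE.
  rewrite -[X in specializes_at _ _ X](antichain_toggleK ratconst_neq0
    (chain_sum_below_lt_neq0 v) (chain_sum_below_gt_neq0 v) x).
  apply: specializes_antichain_toggle.
  - exact: embed_inj.
  - exact: specializes_ratmap_of.
  - exact: specializes_const.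
  - right; apply: antichain_toggle_denom_neq0.
    + exact: ratconst_neq0.
    + exact: label_neq0.
    + exact: chain_sum_below_lt_neq0.
    + exact: chain_sum_below_gt_neq0.
exact: (birational_of_inverse self self).
Qed.

Lemma birational_Theta : birational (Theta C : ratmap P K).
Proof.
have self x : specializes_at (Theta C) (Theta C x) (X x).
  rewrite [Theta C x]ffunE.
  rewrite -[X in specializes_at _ _ X](ThetaK X ratconst_neq0 x).
  apply: specializes_Theta.
  - exact: specializes_ratmap_of.
  - exact: specializes_const.
  - by right; apply: Theta_neq0; [apply: ratconst_neq0 | apply: label_neq0].
exact: (birational_of_inverse self self).
Qed.

(** The inverse is the map given by [nabla_inv] on the generic labeling. *)
Lemma birational_nabla : birational (nabla : ratmap P K).
Proof.
apply: (@birational_of_inverse _ _ _ (ratmap_of (@nabla_inv d P L))) => x.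
  rewrite ffunE -[X in specializes_at _ _ X](nablaK lower_sum_label_neq0 x).
  apply: specializes_chain_sum_to; first exact: embed_inj.
  exact: specializes_ratmap_of.
rewrite [nabla x]ffunE.
rewrite -[X in specializes_at _ _ X](nabla_invK (lower_sum_nabla_inv_neq0 x)).
apply: specializes_nabla; first exact: embed_inj.
  exact: specializes_ratmap_of.
right; exact: lower_sum_nabla_inv_neq0.
Qed.

Lemma birational_Delta_inv : birational (Delta_inv : ratmap P K).
Proof.
apply: (@birational_of_inverse _ _ _ (ratmap_of (@Delta_formula d P L))) => x.
  rewrite ffunE.
  rewrite -[X in specializes_at _ _ X](Delta_invK (upper_sum_Delta_inv_neq0 x)).
  apply: specializes_Delta; first exact: embed_inj.
    exact: specializes_ratmap_of.
  right; exact: upper_sum_Delta_inv_neq0.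
rewrite [Delta_inv x]ffunE.
rewrite -[X in specializes_at _ _ X](DeltaK upper_sum_label_neq0 x).
apply: specializes_Delta_inv; first exact: embed_inj.
exact: specializes_ratmap_of.
Qed.

(** It is the value at [F] of the generic lower sum, and a dominant map sends only zero to zero. *)
Lemma lower_sum_dominant_neq0 F v : dominant F -> lower_sum F v != 0.
Proof.
move=> domF; apply: contra_neq (lower_sum_label_neq0 v) => F0.
apply: (specializes_inj0 domF); rewrite -F0.
apply: (@specializes_lower_sum _ _ _ _ _ (@embed P K)); first exact: embed_inj.
exact: specializes_label.
Qed.

(** Turns composition of rational maps into evaluation of a formula on the components of [F], so
    that sweeps can be followed label by label. *)
Lemma ratcomp_formula (Phi : (P -> L) -> P -> L) F x : dominant F ->
  specializes_at F (Phi X x) (Phi F x) ->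
  ratcomp (ratmap_of Phi) F x = Phi F x.
Proof. by move=> domF spPhi; rewrite !ffunE; apply: rat_substE. Qed.

Lemma comp_order_toggle F v x : dominant F ->
  ratcomp (order_toggle C v) F x = order_toggle_formula cC v F x.
Proof.
move=> domF; apply: ratcomp_formula => //; apply: specializes_order_toggle.
- exact: embed_inj.
- exact: specializes_label.
- exact: specializes_const.
- by left.
- by left.
Qed.

Lemma comp_antichain_toggle F v x : dominant F ->
  ratcomp (antichain_toggle C v) F x = antichain_toggle_formula cC v F x.
Proof.
move=> domF; apply: ratcomp_formula => //; apply: specializes_antichain_toggle.
- exact: embed_inj.
- exact: specializes_label.
- exact: specializes_const.
- by left.
Qed.

Lemma comp_Theta F x : dominant F ->
  ratcomp (Theta C) F x = Theta_formula cC F x.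
Proof.
move=> domF; apply: ratcomp_formula => //; apply: specializes_Theta.
- exact: specializes_label.
- exact: specializes_const.
- by left.
Qed.

Lemma comp_nabla F x : dominant F -> ratcomp nabla F x = nabla_formula F x.
Proof.
move=> domF; apply: ratcomp_formula => //; apply: specializes_nabla.
- exact: embed_inj.
- exact: specializes_label.
- by left.
Qed.

Definition rowmotion_formula (f : P -> L) : P -> L :=
  nabla_formula (Theta_formula cC (Delta_inv_formula f)).

Lemma specializes_rowmotion_formula F x : dominant F ->
  specializes_at F (rowmotion_formula X x) (rowmotion_formula F x).
Proof.
move=> domF; apply: specializes_nabla; [exact: embed_inj| | by left] => y.
apply: specializes_Theta; [| exact: specializes_const | by left].
by apply: specializes_Delta_inv; [exact: embed_inj | exact: specializes_label].
Qed.

Lemma nabla_Theta_Delta_invE :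
  (nabla \o Theta C \o Delta_inv)%ratmap = ratmap_of rowmotion_formula.
Proof.
have [domD _] := birational_Delta_inv; have [domT _] := birational_Theta.
(* Composition associates to the left: the components of nabla after Theta are computed first and
   then specialized at [Delta_inv]. *)
apply/ffunP => x; rewrite ffunE comp_nabla // [RHS]ffunE.
apply: rat_substE => //.
apply: specializes_nabla; [exact: embed_inj| | by left] => y.
rewrite ffunE; apply: specializes_Theta; [| exact: specializes_const | by left].
exact: specializes_ratmap_of.
Qed.

(** Invariant of the upward sweep. Dominance is carried along because evaluating the next toggle on
    the current labels depends on it. *)
Lemma BAR_prefix (s1 s2 : seq P) : linear_extension (s1 ++ s2) ->
  dominant (BAR C s1) /\
  forall x, BAR C s1 x = if x \in s1 then rowmotion_formula X x else X x.
Proof.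
elim/last_ind: s1 s2 => [|s1 v IHs] s2.
  by move=> _; split=> [|x]; [apply: dominant_ratid | rewrite ffunE].
rewrite cat_rcons => les; have [domF FE] := IHs _ les.
have [lt1 ge1 _ _] := linear_extension_split les.
have domv : dominant (antichain_toggle C v).
  by have [] := birational_antichain_toggle v.
rewrite /BAR foldl_rcons -/(BAR C s1); split=> [|x].
  exact: dominant_comp.
rewrite comp_antichain_toggle // mem_rcons inE.
have [->|xv] := eqVneq x v; last first.
  by rewrite antichain_toggleE (negPf xv) FE.
apply: antichain_toggle_step => [w|w /lt1 w1|w /ge1 w1].
(* The labels in question are the components of the dominant map Theta after [Delta_inv], so their
   lower sums are nonzero. *)
- rewrite -(@eq_lower_sum _ _ _ (ratcomp (Theta C) Delta_inv)).
    apply: lower_sum_dominant_neq0; apply: dominant_comp.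
      by have [] := birational_Theta.
    by have [] := birational_Delta_inv.
  move=> y _; rewrite comp_Theta; last by have [] := birational_Delta_inv.
  by rewrite /Theta_formula ffunE.
- by rewrite FE w1.
- by rewrite FE (negPf w1).
Qed.

Lemma BAR_E s : linear_extension s -> BAR C s = ratmap_of rowmotion_formula.
Proof.
move=> les; have := les; rewrite -[s in linear_extension s]cats0.
case/BAR_prefix => _ FE; apply/ffunP => x; rewrite FE ffunE.
by case: les => _ -> _.
Qed.

(** Invariant of the downward sweep: the rightmost toggle acts first, so the elements already
    treated form a suffix. *)
Lemma BOR_suffix (s1 s2 : seq P) : linear_extension (s1 ++ s2) ->
  dominant (BOR C s2) /\
  forall x, BOR C s2 x =
    if x \in s2 then cC / Delta_inv_formula (nabla_formula X) x else X x.
Proof.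
elim: s2 s1 => [|v s2 IHs] s1.
  by move=> _; split=> [|x]; [apply: dominant_ratid | rewrite ffunE].
move=> les; have [_ _ gt2 le2] := linear_extension_split les.
have [domF FE] : dominant (BOR C s2) /\ forall x, BOR C s2 x =
    if x \in s2 then cC / Delta_inv_formula (nabla_formula X) x else X x.
  by apply: (IHs (rcons s1 v)); rewrite cat_rcons.
have domv : dominant (order_toggle C v) by have [] := birational_order_toggle v.
rewrite [BOR C _]/= -/(BOR C s2); split=> [|x]; first exact: dominant_comp.
rewrite comp_order_toggle // inE.
have [->|xv] := eqVneq x v; last by rewrite order_toggleE (negPf xv) FE.
apply: order_toggle_step => [w /gt2 w2|w /le2 w2]; rewrite FE ?w2 //.
by rewrite (negPf w2).
Qed.

(** The full downward sweep equals Theta after [Delta_inv] after nabla; applying nabla once more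
    gives the rowmotion formula evaluated at nabla. *)
Lemma nabla_BOR s : linear_extension s ->
  (nabla \o BOR C s)%ratmap = (ratmap_of rowmotion_formula \o nabla)%ratmap.
Proof.
move=> les; have [domF FE] := @BOR_suffix [::] s les.
have [domN _] := birational_nabla.
apply/ffunP => x; rewrite comp_nabla // ratcomp_formula //; last first.
  exact: specializes_rowmotion_formula.
have E y : BOR C s y = Theta_formula cC (Delta_inv_formula nabla) y.
  rewrite FE; case: les => _ -> _; rewrite /Theta_formula; congr (_ / _).
  rewrite !Delta_inv_formulaE; apply: eq_chain_sum_to => z _.
  by rewrite ffunE.
rewrite /rowmotion_formula !nabla_formulaE E; congr (_ / _).
by apply: eq_lower_sum => w _; apply: E.
Qed.

End Birationality.

Theorem theorem3p6 (d : Order.disp_t) (P : finPOrderType d) (K : fieldType)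
    (charK : [pchar K] =i pred0) (C : K) (C_generic : C != 0) :
  [/\ forall v : P, birational (order_toggle C v),
      forall v : P, birational (antichain_toggle C v),
      birational (Theta C : ratmap P K),
      birational (nabla : ratmap P K)
    & birational (Delta_inv : ratmap P K)]
  /\
  forall s t : seq P, linear_extension s -> linear_extension t ->
    BAR C s = (nabla \o Theta C \o Delta_inv)%ratmap /\
    (nabla \o BOR C t)%ratmap = (BAR C s \o nabla)%ratmap.
Proof.
split.
  split.
  - exact: birational_order_toggle.
  - exact: birational_antichain_toggle.
  - exact: birational_Theta.
  - exact: birational_nabla.
  - exact: birational_Delta_inv.
(* [BAR C s] becomes a map that does not mention [s], which is what allows two different linear
   extensions. *)
move=> s t ext_s ext_t; rewrite (BAR_E charK C_generic ext_s).
split; first by rewrite (nabla_Theta_Delta_invE P charK C_generic).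
exact: (nabla_BOR charK C_generic ext_t).
Qed.
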